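(* Let $\dots\to G_1\to G_0$ and $\dots\to H_1\to H_0$ be inverse sequences of countable (possibly non-abelian) groups and homomorphisms, and let $f_i\colon G_i\to H_i$, $i\ge 0$, be homomorphisms commuting with the bonding maps. Then the collection $(f_i)$ is a pro-isomorphism if and only if both induced maps $\varprojlim f_i\colon\varprojlim G_i\to\varprojlim H_i$ and $\varprojlim^1 f_i\colon\varprojlim^1 G_i\to\varprojlim^1 H_i$ are bijections.
   Context: A collection $f_i\colon G_i\to H_i$ of homomorphisms commuting with the bonding maps is a pro-isomorphism if there exist an increasing sequence $k\colon\mathbb N\to\mathbb N$ and homomorphisms $g_i\colon H_{k(i+1)}\to G_{k(i)}$ such that the compositions $g_if_{k(i+1)}\colon G_{k(i+1)}\to G_{k(i)}$ and $f_{k(i)}g_i\colon H_{k(i+1)}\to H_{k(i)}$ equal the bonding maps for all $i$. For an inverse sequence $\dots\xrightarrow{p_1}G_1\xrightarrow{p_0}G_0$ of groups, the group $\prod_i G_i$ acts on the set $\prod_i G_i$ on the right by $(g_0,g_1,\dots)\cdot(x_0,x_1,\dots)=(x_0^{-1}g_0p_0(x_1),\,x_1^{-1}g_1p_1(x_2),\dots)$; the derived limit $\varprojlim^1 G_i$ is the set of orbits of this action, pointed by the orbit of $(1,1,\dots)$. *)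

(* Defs.v *)
From mathcomp Require Import all_boot.
From mathcomp Require Import boolp classical_sets functions cardinality.

Set Implicit Arguments.
Unset Strict Implicit.
Unset Printing Implicit Defensive.

Local Open Scope group_scope.
Local Open Scope quotient_scope.

Lemma hom1 (A B : groupType) (h : {multiplicative A -> B}) : h 1 = 1.
Proof. by apply: (mulgI (h 1)); rewrite -gmulfM !mulg1. Qed.

Section Bonding.
Context {G : nat -> groupType}.
Variable p : forall i, {multiplicative G i.+1 -> G i}.

Fixpoint bond_iter (i d : nat) : G (d + i)%N -> G i :=
  match d with
  | 0 => fun x => x
  | d'.+1 => fun x => bond_iter (p (d' + i)%N x)
  end.

(* The bonding map from level j to level i: the cast along j = (j - i) + i,
   followed by j - i successive maps p. *)
Definition bond (i j : nat) (le_ij : (i <= j)%N) (x : G j) : G i :=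
  bond_iter (ecast m (G m) (esym (subnK le_ij)) x).

Lemma bondxx i (le_ii : (i <= i)%N) x : bond le_ii x = x.
Proof.
rewrite /bond; move: (esym (subnK le_ii)); rewrite subnn => e.
by rewrite (eq_axiomK e).
Qed.

Lemma bondS i j (le_ij : (i <= j)%N) (le_ijS : (i <= j.+1)%N) x :
  bond le_ijS x = bond le_ij (p j x).
Proof.
rewrite /bond; move: (esym (subnK le_ijS)) (esym (subnK le_ij)).
rewrite subSn //; move: (j - i)%N => d e e'.
by subst j; rewrite (eq_axiomK (e : (d + i).+1 = (d + i).+1)).
Qed.

Definition lim : Type := {x : forall i, G i | forall i, p i (x i.+1) = x i}.

Definition lim1_act (g x : forall i, G i) : forall i, G i :=
  fun i => (x i)^-1 * g i * p i (x i.+1).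

Definition same_orbit (g h : forall i, G i) : bool :=
  `[< exists x : forall i, G i, h = lim1_act g x >].

Lemma lim1_act1 g : lim1_act g (fun=> 1) = g.
Proof.
by apply: functional_extensionality_dep => i; rewrite /lim1_act hom1 invg1 mul1g mulg1.
Qed.

Lemma lim1_actM g x y :
  lim1_act g (fun i => x i * y i) = lim1_act (lim1_act g x) y.
Proof.
by apply: functional_extensionality_dep => i;
  rewrite /lim1_act gmulfM invgM !mulgA.
Qed.

Lemma same_orbit_refl : reflexive same_orbit.
Proof. by move=> g; apply/asboolP; exists (fun=> 1); rewrite lim1_act1. Qed.

Lemma same_orbit_sym : symmetric same_orbit.
Proof.
suff sub g h : same_orbit g h -> same_orbit h g.
  by move=> g h; apply/idP/idP; apply: sub.
move=> /asboolP[x ->]; apply/asboolP; exists (fun i => (x i)^-1).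
rewrite -lim1_actM -[LHS]lim1_act1; congr lim1_act.
by apply: functional_extensionality_dep => i; rewrite mulgV.
Qed.

Lemma same_orbit_trans : transitive same_orbit.
Proof.
move=> h g k /asboolP[x ->] /asboolP[y ->]; apply/asboolP.
by exists (fun i => x i * y i); rewrite lim1_actM.
Qed.

Canonical same_orbit_equiv :=
  EquivRel same_orbit same_orbit_refl same_orbit_sym same_orbit_trans.

Definition lim1 : Type := {eq_quot same_orbit}.

End Bonding.

Arguments lim {G} p.
Arguments lim1 {G} p.

Section InducedMaps.
Context {G H : nat -> groupType}.
Context {p : forall i, {multiplicative G i.+1 -> G i}}.
Context {q : forall i, {multiplicative H i.+1 -> H i}}.
Variable f : forall i, {multiplicative G i -> H i}.

Definition commutes_with_bonds : Prop :=
  forall i (x : G i.+1), f i (p i x) = q i (f i.+1 x).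

Hypothesis fpq : commutes_with_bonds.

Lemma lim_map_subproof (x : lim p) (i : nat) :
  q i (f i.+1 (sval x i.+1)) = f i (sval x i).
Proof. by rewrite -fpq (svalP x). Qed.

Definition lim_map (x : lim p) : lim q :=
  exist _ (fun i => f i (sval x i)) (lim_map_subproof x).

(* Defined through a representative; independence of it is lim1_map_pi. *)
Definition lim1_map (c : lim1 p) : lim1 q :=
  \pi_({eq_quot same_orbit q}) (fun i => f i (repr c i)).

Lemma lim1_map_pi (g : forall i, G i) :
  lim1_map (\pi_({eq_quot same_orbit p}) g)
  = \pi_({eq_quot same_orbit q}) (fun i => f i (g i)).
Proof.
apply/eqmodP/asboolP; rewrite /=.
have /eqmodP/asboolP[x gE] :
    repr (\pi_({eq_quot same_orbit p}) g) = g %[mod {eq_quot same_orbit p}].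
  by rewrite reprK.
exists (fun i => f i (x i)); apply: functional_extensionality_dep => i.
rewrite [in LHS]gE /lim1_act !gmulfM fpq; congr (_ * _ * _).
by apply: (mulgI (f i (x i))); rewrite -gmulfM !mulgV hom1.
Qed.

End InducedMaps.

Arguments commutes_with_bonds {G H} p q f.

Definition pro_isomorphism (G H : nat -> groupType)
    (p : forall i, {multiplicative G i.+1 -> G i})
    (q : forall i, {multiplicative H i.+1 -> H i})
    (f : forall i, {multiplicative G i -> H i}) : Prop :=
  exists (k : nat -> nat) (k_incr : {homo k : m n / (m < n)%N})
         (g : forall i, {multiplicative H (k i.+1) -> G (k i)}),
  forall i,
    let le_k := ltnW (k_incr i i.+1 (ltnSn i)) in
    (forall x : G (k i.+1), g i (f (k i.+1) x) = bond p le_k x) /\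
    (forall y : H (k i.+1), f (k i) (g i y) = bond q le_k y).

(* Main.v *)
Require Import Defs.
From HB Require Import structures.
From mathcomp Require Import all_boot.
From mathcomp Require Import boolp classical_sets functions cardinality.

(* A level morphism is a pro-isomorphism iff each G_i kills ker f_j for j large and
   each im f_i contains the image of H_j for j large. Given these two conditions,
   elements of lim and lim^1 are lifted by truncating the infinite products
   h_i p(h_(i+1)) p(h_(i+2)) ... at a stage from which the bonding maps into G_i
   vanish on kernels (or land in im f_i).

   Conversely, both conditions have the form "S_j maps into I_i for j large", with
   subgroups I_i <= S_i equal to 1 <= ker f_i, resp. to im f_i <= H_i. Bijectivity of
   lim and lim^1 says that for every family h in prod S_i the sequence of coset
   sets S_i/I_i with bonding maps twisted by h has a nonempty limit, and that the
   untwisted limit is a point. If the images of S_j/I_j in the countable set S_i/I_i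
   did not stabilize, a diagonal choice of h would exclude every element of S_i/I_i
   from the twisted limit; so the sequence is Mittag-Leffler, its stable images are
   covered by the limit, and hence they are trivial. *)

Set Implicit Arguments.
Unset Strict Implicit.
Unset Printing Implicit Defensive.

Local Open Scope group_scope.
Local Open Scope quotient_scope.

Definition dep_choice (I : Type) (T : I -> Type) (P : forall i, T i -> Prop)
    (exP : forall i, exists x, P i x) : {x : forall i, T i | forall i, P i (x i)} :=
  exist (fun x : forall i, T i => forall i, P i (x i))
    (fun i => sval (cid (exP i))) (fun i => svalP (cid (exP i))).

Lemma homV (A B : groupType) (h : {multiplicative A -> B}) (x : A) : h x^-1 = (h x)^-1.
Proof. by apply: (mulgI (h x)); rewrite -gmulfM !mulgV hom1. Qed.

(** * Bonding maps between arbitrary levels, and levelwise subgroups preserved by them *)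

Section Proj.
Context {G : nat -> groupType}.
Variable p : forall i, {multiplicative G i.+1 -> G i}.

(* The bonding map made total, with the junk value 1 when j < i. *)
Definition proj (i j : nat) (x : G j) : G i :=
  match @idP (i <= j)%N with
  | ReflectT le_ij => bond p le_ij x
  | ReflectF _ => 1
  end.

Lemma projE i j (le_ij : (i <= j)%N) x : bond p le_ij x = proj i x.
Proof.
rewrite /proj; case: {-}_ / idP => // le_ij'.
by rewrite (eq_irrelevance le_ij le_ij').
Qed.

Lemma proj_gt i j (x : G j) : (j < i)%N -> proj i x = 1.
Proof.
by rewrite ltnNge => /negP lt_ji; rewrite /proj; case: {-}_ / idP.
Qed.

Lemma proj_id i (x : G i) : proj i x = x.
Proof. by rewrite -(projE (leqnn i)) bondxx. Qed.

Lemma projS i j (x : G j.+1) : (i <= j)%N -> proj i x = proj i (p j x).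
Proof.
move=> le_ij; rewrite -(projE le_ij) -(projE (leqW le_ij)); exact: bondS.
Qed.

Lemma projM i j (x y : G j) : proj i (x * y) = proj i x * proj i y.
Proof.
have [le_ij|lt_ji] := leqP i j; last by rewrite !proj_gt ?mulg1.
elim: j le_ij x y => [|j IHj].
  by rewrite leqn0 => /eqP-> x y; rewrite !proj_id.
rewrite leq_eqVlt => /predU1P[-> x y|]; first by rewrite !proj_id.
by rewrite ltnS => le_ij x y; rewrite !projS // gmulfM IHj.
Qed.

Lemma proj1 i j : proj i (1 : G j) = 1.
Proof. by apply: (mulgI (proj i (1 : G j))); rewrite -projM !mulg1. Qed.

Lemma projV i j (x : G j) : proj i x^-1 = (proj i x)^-1.
Proof. by apply: (mulgI (proj i x)); rewrite -projM !mulgV proj1. Qed.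

Lemma bond_proj i j (x : G j) : (i < j)%N -> p i (proj i.+1 x) = proj i x.
Proof.
elim: j x => // j IHj x; rewrite ltnS leq_eqVlt => /predU1P[->|lt_ij].
  by rewrite proj_id projS // proj_id.
by rewrite !projS ?(ltnW lt_ij) // IHj.
Qed.

Lemma proj_trans i j l (x : G l) :
  (i <= j)%N -> (j <= l)%N -> proj i (proj j x) = proj i x.
Proof.
move=> le_ij; elim: l x => [|l IHl] x.
  by rewrite leqn0 => /eqP e; subst j; rewrite proj_id.
rewrite leq_eqVlt => /predU1P[e|]; first by subst j; rewrite proj_id.
by rewrite ltnS => le_jl; rewrite (projS (i := j)) // IHl // -projS ?(leq_trans le_ij).
Qed.

Lemma lim_eq (x y : lim p) : (forall i, sval x i = sval y i) -> x = y.
Proof.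
case: x y => [x limx] [y limy] /= eq_xy.
have {eq_xy} e : x = y := functional_extensionality_dep eq_xy.
by subst y; congr exist; apply: Prop_irrelevance.
Qed.

Lemma proj_lim (x : forall i, G i) i j :
  (forall i, p i (x i.+1) = x i) -> (i <= j)%N -> proj i (x j) = x i.
Proof.
move=> limx; elim: j => [|j IHj]; first by rewrite leqn0 => /eqP->; rewrite proj_id.
rewrite leq_eqVlt => /predU1P[->|]; first by rewrite proj_id.
by rewrite ltnS => le_ij; rewrite projS // limx IHj.
Qed.

Record subsystem (S : forall i, G i -> Prop) : Prop := Subsystem {
  subsystem1 : forall i, S i 1;
  subsystemM : forall i x y, S i x -> S i y -> S i (x * y);
  subsystemV : forall i x, S i x -> S i x^-1;
  subsystem_bond : forall i x, S i.+1 x -> S i (p i x)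
}.

Lemma subsystem_proj S i j (x : G j) : subsystem S -> S j x -> S i (proj i x).
Proof.
move=> subS; have [le_ij|lt_ji] := leqP i j; last first.
  by rewrite proj_gt // => _; exact: subsystem1.
elim: j le_ij x => [|j IHj].
  by rewrite leqn0 => /eqP-> x; rewrite proj_id.
rewrite leq_eqVlt => /predU1P[-> x|]; first by rewrite proj_id.
by rewrite ltnS => le_ij x Sx; rewrite projS //; apply: (IHj le_ij); apply: (subsystem_bond subS).
Qed.

(** * Stabilization and triviality of the coset sequence S_i/I_i *)

Section Trivial.
Context {S I : forall i, G i -> Prop}.
Hypotheses (subS : subsystem S) (subI : subsystem I).

Section ML.
Variable i : nat.
Hypothesis countG : countable [set: G i]%classic.
Hypothesis lim_twisted : forall h, (forall j, S (h j)) ->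
  exists2 x : forall j, G j, (forall j, S (x j)) &
    forall j, I ((x j)^-1 * h j * p j (x j.+1)).

(* Membership of c I_i in the image of S_j/I_j under the twisted bonding map, u being
   the product of the twists between i and j. *)
Definition near (u : G i) (j : nat) (c : G i) : Prop :=
  exists (s : G j) (a : G i), [/\ S s, I a & c = u * proj i s * a].

Lemma near_next u j (h : G j) c : S h -> (i <= j)%N -> near (u * proj i h) j.+1 c -> near u j c.
Proof.
move=> Sh le_ij [s [a [Ss Ia ->]]]; exists (h * p j s), a; split => //.
  by apply: (subsystemM subS) => //; apply: (subsystem_bond subS).
by rewrite projM projS // !mulgA.
Qed.

(** The component [x i] given by [lim_twisted] for the diagonal twists survives every exclusion. Let
    [c] be the survivor of least code. Once all elements of smaller code are excluded, a failure of
    stability would allow the next twist to exclude [c] as well. *)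
Lemma stationary : exists2 J, (i <= J)%N & forall j (e : G j), (J <= j)%N -> S e ->
  near 1 j.+1 (proj i e).
Proof.
have [code code_inj] : exists code : G i -> nat, injective code.
  have /countable_injP[f f_inj] := countG.
  by exists f => x y; apply: f_inj; rewrite in_setT.
(* The twist at j should exclude, if this is possible in one step, the first coset
   representative (in the order of code) that is not yet excluded. *)
pose improves j u (h : G j) := exists c,
  [/\ forall c', (code c' < code c)%N -> ~ near u j c', near u j c
    & ~ near (u * proj i h) j.+1 c].
pose step j u : G j := if pselect (exists h, S h /\ improves j u h) is left ex
  then sval (cid ex) else 1.
have S_step j u : S (step j u).
  rewrite /step; case: pselect => [ex|_]; last exact: subsystem1.
  by case: cid => /= h [].
(* Each twist is chosen knowing the product of the earlier ones. Factors from levels below [i] are 1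
   by the default value of [proj], so the process really starts at level [i]. *)
pose u := fix u j : G i := if j is j'.+1 then u j' * proj i (step j' (u j')) else 1.
pose h j := step j (u j).
have uS j : u j.+1 = u j * proj i (h j) by [].
have [x Sx xI] := lim_twisted (fun j => S_step j (u j)).
have u1 j : (j <= i)%N -> u j = 1.
  by elim: j => // j IHj lt_ji; rewrite uS IHj ?(ltnW lt_ji) // mul1g proj_gt.
have nearx j : (i <= j)%N -> near (u j) j (x i).
  move=> le_ij; suff [a Ia ->] : exists2 a, I a & x i = u j * proj i (x j) * a.
    by exists (x j), a; split.
  elim: j le_ij => [|j IHj].
    rewrite leqn0 => /eqP i0; exists 1; first exact: subsystem1.
    by rewrite u1 ?i0 // mul1g mulg1 -i0 proj_id.
  rewrite leq_eqVlt => /predU1P[<-|].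
    by exists 1; [exact: subsystem1|rewrite u1 // mul1g mulg1 proj_id].
  rewrite ltnS => le_ij; have [a Ia xiE] := IHj le_ij.
  set b := (x j)^-1 * h j * p j (x j.+1) in xI *.
  exists ((proj i ((x j)^-1 * h j * p j (x j.+1)))^-1 * a).
    apply: (subsystemM subI) => //; apply: (subsystemV subI).
    exact: (subsystem_proj _ subI (xI j)).
  rewrite xiE uS projS // !projM projV !invgM invgK !mulgA.
  by rewrite mulgK mulgK.
have [c [cN c_min]] : exists c, (forall j, (i <= j)%N -> near (u j) j c) /\
    forall c', (code c' < code c)%N -> exists2 j, (i <= j)%N & ~ near (u j) j c'.
  have exn : exists n, `[< exists2 c, code c = n &
      forall j, (i <= j)%N -> near (u j) j c >].
    by exists (code (x i)); apply/asboolP; exists (x i).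
  have [n /asboolP[c cn cN] n_min] := ex_minnP exn.
  exists c; split => // c' lt_c'; apply: contrapT => noj.
  suff : (n <= code c')%N by rewrite -cn leqNgt lt_c'.
  apply/n_min/asboolP; exists c' => // j le_ij; apply: contrapT => nj.
  by apply: noj; exists j.
have near_back c' j l : (i <= j)%N -> (j <= l)%N -> near (u l) l c' -> near (u j) j c'.
  move=> le_ij; elim: l => [|l IHl]; first by rewrite leqn0 => /eqP->.
  rewrite leq_eqVlt => /predU1P[->//|]; rewrite ltnS => le_jl near_l.
  apply: IHl => //; apply: near_next near_l; first exact: S_step.
  exact: leq_trans le_jl.
have [J le_iJ J_far] : exists2 J, (i <= J)%N & forall j c', (J <= j)%N ->
    (code c' < code c)%N -> ~ near (u j) j c'.
  (* Only finitely many codes lie below that of [c]. Raising the bound [n] by one adds at most one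
     element, and by [near_back] an excluded element stays excluded. *)
  suff /(_ (code c)) [J le_iJ JP] : forall n, exists2 J, (i <= J)%N & forall c',
      (code c' < code c)%N -> (code c' < n)%N -> ~ near (u J) J c'.
    exists J => // j c' le_Jj lt_c' /(near_back _ _ _ le_iJ le_Jj); exact: JP.
  elim=> [|n [J le_iJ JP]]; first by exists i.
  have [[d [dn lt_d]]|no_d] := pselect (exists d, code d = n /\ (code d < code c)%N).
    have [j le_ij d_far] := c_min d lt_d.
    exists (maxn J j); first by rewrite leq_max le_iJ.
    move=> c' lt_c'; rewrite ltnS leq_eqVlt => /predU1P[c'n|lt_n].
      move=> /(near_back _ _ _ le_ij (leq_maxr _ _)).
      by rewrite (code_inj c' d) // c'n.
    by move=> /(near_back _ _ _ le_iJ (leq_maxl _ _)); apply: JP.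
  exists J => // c' lt_c'; rewrite ltnS leq_eqVlt => /predU1P[c'n|]; last exact: JP.
  by case: no_d; exists c'.
exists J => // j e le_Jj Se.
have le_ij := leq_trans le_iJ le_Jj.
have [b [a [Sb Ia cE]]] := cN j le_ij.
(* The twist [b * e^-1] is made so that, if [c] is still near at [j.+1], comparing the two
   expressions of [c] cancels [u j] and [b] and leaves [e] equal to [s * (a' * a^-1)] at level
   [i]. *)
have Sbe : S (b * e^-1).
  by apply: (subsystemM subS) => //; apply: (subsystemV subS).
have : near (u j * proj i (b * e^-1)) j.+1 c.
  apply: contrapT => far; have ex : exists g, S g /\ improves j (u j) g.
    exists (b * e^-1); split => //; exists c; split => //; last exact: cN.
    by move=> c'; apply: J_far.
  (* The twist actually used at [j] excludes some [c2]; the minimality of [c] and of [c2] forces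
     [c2 = c], although [c] survives. *)
  have [c2 [c2_least c2_near c2_far]] : improves j (u j) (h j).
    by rewrite /h /step; case: pselect => // ex'; case: cid => /= g [].
  have [lt_c2|lt_c|/code_inj c2E] := ltngtP (code c2) (code c).
  - exact: J_far lt_c2 c2_near.
  - by apply: (c2_least c) => //; apply: cN.
  - by apply: c2_far; rewrite c2E -uS; apply: cN; apply: leqW.
move=> [s [a' [Ss Ia' cE']]]; exists s, (a' * a^-1); split => //.
  by apply: (subsystemM subI) => //; apply: (subsystemV subI).
rewrite mul1g; apply: (mulgI (u j * proj i (b * e^-1))); apply: (mulIg a).
rewrite !mulgA mulgVK -cE' cE projM projV !mulgA.
by rewrite mulgVK.
Qed.

End ML.

Hypothesis countG : forall i, countable [set: G i]%classic.
Hypothesis lim_twisted : forall h, (forall j, S (h j)) ->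
  exists2 x : forall j, G j, (forall j, S (x j)) &
    forall j, I ((x j)^-1 * h j * p j (x j.+1)).
Hypothesis lim_trivial : forall x : forall j, G j, (forall j, S (x j)) ->
  (forall j, I ((x j)^-1 * p j (x j.+1))) -> forall j, I (x j).

(** A stable element at level [i] extends downwards by projection and upwards by stability to a
    point of the untwisted limit of cosets, and [lim_trivial] puts every component of that point in
    [I]. *)
Lemma pro_trivial i : exists2 j, (i <= j)%N & forall s : G j, S s -> I (proj i s).
Proof.
have ML m : exists J, (m <= J)%N /\ forall j l (e : G j), (J <= j)%N -> (j <= l)%N ->
    S e -> exists (s : G l) (a : G m), [/\ S s, I a & proj m e = proj m s * a].
  have [J le_mJ JP] := stationary (countG m) lim_twisted.
  exists J; split => // j l e le_Jj; elim: l => [|l IHl].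
    rewrite leqn0 => /eqP j0 Se; subst j; exists e, 1.
    by rewrite mulg1; split => //; exact: subsystem1.
  rewrite leq_eqVlt => /predU1P[j_l Se|].
    subst j; exists e, 1; rewrite mulg1; split => //; exact: subsystem1.
  rewrite ltnS => le_jl Se; have [s [a [Ss Ia ->]]] := IHl le_jl Se.
  have [s' [a' [Ss' Ia' ->]]] := JP l s (leq_trans le_Jj le_jl) Ss.
  exists s', (a' * a); rewrite mul1g mulgA; split => //; exact: subsystemM.
have [J JP] := choice ML.
exists (J i); first by have [] := JP i.
move=> s Ss.
(* The stationary images, on which the bonding maps are onto modulo I. *)
pose stable m (x : G m) := exists2 j, (J m <= j)%N & exists2 b : G j, S b & proj m b = x.
have lift m x : exists y : G m.+1, stable m x -> stable m.+1 y /\ I (x^-1 * p m y).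
  have [[j le_j [b Sb <-]]|nst] := pselect (stable m x); last by exists 1.
  have [le_mJ JmP] := JP m; have [le_mJ' _] := JP m.+1.
  (* Lifting to a level past [J m.+1] makes the projection of [b'] to [m.+1] stable again, so the
     lifting can be repeated. *)
  have [b' [a [Sb' Ia ->]]] := JmP j (maxn j (J m.+1)) b le_j (leq_maxl _ _) Sb.
  exists (proj m.+1 b') => _; split.
    by exists (maxn j (J m.+1)); [exact: leq_maxr|exists b'].
  rewrite bond_proj ?(leq_trans le_mJ') ?leq_maxr //.
  by rewrite invgM -mulgA mulVg mulg1; apply: (subsystemV subI).
pose next m x : G m.+1 := sval (cid (lift m x)).
pose x := fix x m : G m :=
  if (m <= i)%N then proj m (proj i s) else if m is m'.+1 then next m' (x m') else 1.
have x_le m : (m <= i)%N -> x m = proj m (proj i s) by case: m => //= m ->.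
have xS m : (i <= m)%N -> x m.+1 = next m (x m) by rewrite /= leqNgt => /negbTE/= ->.
have x_i : x i = proj i s by rewrite x_le ?proj_id.
have nextP m y : stable m y -> stable m.+1 (next m y) /\ I (y^-1 * p m (next m y)).
  exact: svalP (cid (lift m y)).
have x_stable m : (i <= m)%N -> stable m (x m).
  elim: m => [|m IHm].
    by rewrite leqn0 => /eqP i0; rewrite -i0 x_i; exists (J i) => //; exists s.
  rewrite leq_eqVlt => /predU1P[<-|]; first by rewrite x_i; exists (J i) => //; exists s.
  by rewrite ltnS => le_im; rewrite xS //; apply: (nextP _ _ (IHm le_im)).1.
rewrite -x_i; apply: lim_trivial => m.
  have [le_mi|/ltnW/x_stable[j _ [b Sb <-]]] := leqP m i; last exact: subsystem_proj.
  by rewrite x_le //; do 2!apply: subsystem_proj => //.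
have [lt_mi|le_im] := ltnP m i.
  by rewrite !x_le ?(ltnW lt_mi) // bond_proj // mulVg; exact: subsystem1.
by rewrite xS //; apply: (nextP _ _ (x_stable m le_im)).2.
Qed.

End Trivial.
End Proj.

(** * Partial products and the orbit relation of lim^1 *)

Section PartialProducts.
Context {G : nat -> groupType}.
Variable p : forall i, {multiplicative G i.+1 -> G i}.
Implicit Types g h : forall i, G i.

(* h_i p(h_(i+1)) ... p(h_(j-1)), since proj is 1 on the factors below i. *)
Fixpoint pprod h (i j : nat) : G i :=
  if j is j'.+1 then pprod h i j' * proj p i (h j') else 1.

Lemma pprod_ge h i j : (j <= i)%N -> pprod h i j = 1.
Proof. by elim: j => //= j IHj lt_ji; rewrite IHj ?(ltnW lt_ji) // proj_gt // mul1g. Qed.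

Lemma pprod_cons h i j : (i < j)%N -> pprod h i j = h i * p i (pprod h i.+1 j).
Proof.
elim: j => // j IHj; rewrite ltnS leq_eqVlt => /predU1P[->|lt_ij].
  by rewrite (pprod_ge _ (leqnn _)) /= pprod_ge // proj_id hom1 mul1g mulg1.
by rewrite /= IHj // gmulfM bond_proj // mulgA.
Qed.

Lemma pprod_cat h i j l : (i <= j)%N -> (j <= l)%N ->
  pprod h i l = pprod h i j * proj p i (pprod h j l).
Proof.
move=> le_ij; elim: l => [|l IHl].
  by rewrite leqn0 => /eqP j0; subst j; rewrite /= proj1 mulg1.
rewrite leq_eqVlt => /predU1P[<-|]; first by rewrite (pprod_ge _ (leqnn j)) proj1 mulg1.
rewrite ltnS => le_jl; rewrite /= IHl // projM mulgA; congr (_ * _).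
by rewrite proj_trans.
Qed.

Lemma lim1_eqP g h :
  \pi_({eq_quot same_orbit p}) g = \pi_({eq_quot same_orbit p}) h <->
  exists x : forall i, G i, forall i, h i = (x i)^-1 * g i * p i (x i.+1).
Proof.
split=> [/eqmodP/asboolP[x ->]|[x hE]]; first by exists x.
by apply/eqmodP/asboolP; exists x; apply: functional_extensionality_dep.
Qed.

(* Unrolling the action: x_i = g_i p(x_(i+1)) h_i^-1, iterated j - i times. *)
Lemma lim1_act_iter g h (x : forall i, G i) i j : (i <= j)%N ->
  (forall i, h i = (x i)^-1 * g i * p i (x i.+1)) ->
  x i = pprod g i j * proj p i (x j) * (pprod h i j)^-1.
Proof.
move=> le_ij hE; elim: j le_ij => [|j IHj].
  by rewrite leqn0 => /eqP->; rewrite /= proj_id mul1g invg1 mulg1.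
rewrite leq_eqVlt => /predU1P[<-|].
  by rewrite !pprod_ge // proj_id mul1g invg1 mulg1.
rewrite ltnS => le_ij; rewrite {1}IHj //= (projS _ (x j.+1)) // hE.
by rewrite !projM projV !invgM invgK !mulgA mulgK mulgK.
Qed.

End PartialProducts.

Lemma inj_surj_bijective (A B : Type) (f : A -> B) :
  injective f -> (forall y, exists x, f x = y) -> bijective f.
Proof.
by move=> f_inj /choice[g fg]; exists g => // x; apply: f_inj; rewrite fg.
Qed.

(** * Pro-isomorphisms in terms of kernels and images *)

Section ProMorphism.
Context {G H : nat -> groupType}.
Context {p : forall i, {multiplicative G i.+1 -> G i}}.
Context {q : forall i, {multiplicative H i.+1 -> H i}}.
Context {f : forall i, {multiplicative G i -> H i}}.
Hypothesis fpq : commutes_with_bonds p q f.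

Lemma map_proj i j (x : G j) : f i (proj p i x) = proj q i (f j x).
Proof.
have [le_ij|lt_ji] := leqP i j; last by rewrite !proj_gt ?hom1.
elim: j le_ij x => [|j IHj].
  by rewrite leqn0 => /eqP-> x; rewrite !proj_id.
rewrite leq_eqVlt => /predU1P[-> x|]; first by rewrite !proj_id.
by rewrite ltnS => le_ij x; rewrite !projS // IHj // fpq.
Qed.

Lemma map_pprod h i j : f i (pprod p h i j) = pprod q (fun m => f m (h m)) i j.
Proof. by elim: j => [|j IHj] /=; rewrite ?hom1 // gmulfM IHj map_proj. Qed.

Definition pro_mono : Prop := forall i, exists J, (i <= J)%N /\
  forall j (x : G j), (J <= j)%N -> f j x = 1 -> proj p i x = 1.

Definition pro_epi : Prop := forall i, exists J, (i <= J)%N /\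
  forall j (y : H j), (J <= j)%N -> exists x, f i x = proj q i y.

(** The bonding map from [k i.+1] to [k i] factors through [f (k i.+1)] in [G], so it kills the
    kernel, and through [f (k i)] in [H], so it lands in the image. As [i <= k i], the stage
    [k i.+1] serves for [i]. *)
Lemma pro_isomorphism_mono_epi : pro_isomorphism p q f -> pro_mono /\ pro_epi.
Proof.
move=> [k [k_incr [g gP]]].
have le_k i : (i <= k i)%N.
  by elim: i => // i IHi; apply: leq_ltn_trans IHi (k_incr _ _ (ltnSn i)).
have le_kS i : (k i <= k i.+1)%N := ltnW (k_incr i i.+1 (ltnSn i)).
split=> i; exists (k i.+1); split; try exact: leq_trans (le_k i) (le_kS i).
  move=> j x le_j fx; rewrite -(proj_trans _ _ (leq_trans (le_k i) (le_kS i)) le_j).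
  rewrite -(proj_trans _ _ (le_k i) (le_kS i)).
  have <- : g i (f (k i.+1) (proj p (k i.+1) x)) = proj p (k i) (proj p (k i.+1) x).
    by rewrite (gP i).1 projE.
  rewrite map_proj fx.
  by rewrite proj1 hom1 proj1.
move=> j y le_j; exists (proj p i (g i (proj q (k i.+1) y))).
rewrite map_proj (gP i).2 projE !proj_trans //.
exact: leq_trans (le_k i) (le_kS i).
Qed.

(** The map back is a zigzag: project to [H m], lift through [f m], project to [G i]. Two lifts
    differ by an element of the kernel of [f m], which dies in [G i]; hence the result is a
    homomorphism. *)
Lemma mono_epi_pro_isomorphism : pro_mono -> pro_epi -> pro_isomorphism p q f.
Proof.
move=> mono epi.
have step i : exists j, exists g : {multiplicative H j -> G i}, (i < j)%N /\
    (forall x, g (f j x) = proj p i x) /\ (forall y, f i (g y) = proj q i y).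
  have [m [le_im mP]] := mono i; have [n [le_mn nP]] := epi m.
  (* Level [n.+1] rather than [n] ensures that the index strictly increases. *)
  have lift (y : H n.+1) : exists x : G m, f m x = proj q m y by apply/nP/leqnSn.
  have [s sP] := choice lift.
  have gP x y : f m x = proj q m y -> proj p i (s y) = proj p i x.
    move=> xy; apply: (mulIg (proj p i x)^-1); rewrite mulgV -projV -projM.
    by apply: (mP m) => //; rewrite gmulfM homV xy sP mulgV.
  have gM : {morph (fun y => proj p i (s y)) : y z / y * z}.
    by move=> y z; rewrite -projM; apply: gP; rewrite gmulfM !sP projM.
  pose g : {multiplicative H n.+1 -> G i} := HB.pack (fun y => proj p i (s y))
    (isMultiplicative.Build _ _ (fun y => proj p i (s y)) gM).
  exists n.+1, g; split; [by rewrite ltnS (leq_trans le_im)|split].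
    move=> x; rewrite /= (gP (proj p m x)) ?map_proj //.
    by rewrite proj_trans // (leq_trans le_mn).
  by move=> y; rewrite /= map_proj sP proj_trans // (leq_trans le_mn).
pose nxt i := sval (cid (step i)); pose k n := iter n nxt 0%N.
have k_incr : {homo k : m n / (m < n)%N}.
  apply: homo_ltn => [? ? ?|n]; first exact: ltn_trans.
  by have [g []] := svalP (cid (step (k n))).
pose g n := svalP (cid (step (k n))).
exists k, k_incr, (fun n => sval (cid (g n))) => n le_k.
have [_ [gf fg]] := svalP (cid (g n)).
by split=> x; rewrite projE ?gf ?fg.
Qed.

(** * Bijectivity on lim and lim^1 from the two conditions *)

Section MonoEpiLimits.
Hypotheses (mono : pro_mono) (epi : pro_epi).

Lemma mono_lim_injective : injective (lim_map fpq).
Proof.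
move=> x y /(congr1 sval)/= fxy; apply: lim_eq => i.
have [J [le_iJ JP]] := mono i.
rewrite -(proj_lim (svalP x) le_iJ) -(proj_lim (svalP y) le_iJ).
apply: (mulIg (proj p i (sval y J))^-1); rewrite mulgV -projV -projM.
apply: (JP J) => //; rewrite gmulfM homV.
have := congr1 (fun u => u J) fxy => /= ->; exact: mulgV.
Qed.

(** Arbitrary lifts [u] of the components need not be compatible, but after projection from level
    [J i] to [i] they no longer depend on the choice or on the level. *)
Lemma mono_epi_lim_surjective (y : lim q) : exists x, lim_map fpq x = y.
Proof.
have y_im i : exists x, f i x = sval y i.
  have [J [le_iJ JP]] := epi i; have [x fx] := JP J (sval y J) (leqnn J).
  by exists x; rewrite fx (proj_lim (svalP y)).
have [u uP] := dep_choice y_im; have [J JP] := choice mono.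
have x_indep i l (v : G l) : (J i <= l)%N -> f l v = sval y l ->
    proj p i v = proj p i (u (J i)).
  have [le_iJ JiP] := JP i => le_l fv; rewrite -(proj_trans _ _ le_iJ le_l).
  apply: (mulIg (proj p i (u (J i)))^-1); rewrite mulgV -projV -projM.
  apply: (JiP (J i)) => //.
  by rewrite gmulfM homV uP map_proj fv (proj_lim (svalP y)) // mulgV.
have limx i : p i (proj p i.+1 (u (J i.+1))) = proj p i (u (J i)).
  have [[le_iJ _] [le_iJS _]] := (JP i, JP i.+1).
  rewrite -(x_indep i.+1 (maxn (J i) (J i.+1)) (u _)) ?leq_maxr // bond_proj.
    by rewrite (x_indep i) ?leq_maxl.
  by rewrite (leq_trans le_iJS) ?leq_maxr.
exists (exist _ (fun i => proj p i (u (J i))) limx); apply: lim_eq => i /=.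
by rewrite map_proj uP (proj_lim (svalP y)) //; have [] := JP i.
Qed.

(** The full infinite product would carry [h] to the base point. Truncating it at [J i] costs only a
    right factor in the image of [f i], so acting by [x] moves [h] into the image of [f]. *)
Lemma epi_lim1_surjective (c : lim1 q) : exists b : lim1 p, lim1_map f b = c.
Proof.
rewrite -[c]reprK; set h := repr c; have [J JP] := choice epi.
pose x i := pprod q h i (J i).
have xE i l : (J i <= l)%N -> exists a, x i = pprod q h i l * f i a.
  have [le_iJ JiP] := JP i => le_l; rewrite (pprod_cat _ _ le_iJ le_l).
  have [a fa] := JiP (J i) (pprod q h (J i) l) (leqnn _).
  by exists a^-1; rewrite homV fa mulgK.
have g_ex i : exists g, f i g = (x i)^-1 * h i * q i (x i.+1).
  pose l := maxn (J i) (J i.+1); have [le_iJS _] := JP i.+1.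
  have lt_il : (i < l)%N by rewrite (leq_trans le_iJS) ?leq_maxr.
  have [a ->] := xE i l (leq_maxl _ _); have [b ->] := xE i.+1 l (leq_maxr _ _).
  exists (a^-1 * p i b); rewrite !gmulfM homV fpq invgM (pprod_cons _ _ lt_il).
  by rewrite !mulgA -(mulgA _ (h i)) mulgVK.
have [g gP] := dep_choice g_ex.
exists (\pi_({eq_quot same_orbit p}) g); rewrite (lim1_map_pi fpq).
by apply/esym/lim1_eqP; exists x.
Qed.

(** First [pro_epi] lifts the element relating the two images, which reduces to families [h] and
    [g'] with equal images under [f]; then [pro_mono] makes their truncated products comparable. *)
Lemma mono_epi_lim1_injective : injective (lim1_map f : lim1 p -> lim1 q).
Proof.
move=> b c; rewrite -[b]reprK -[c]reprK !(lim1_map_pi fpq).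
set g := repr b; set g' := repr c => /lim1_eqP[y yP].
have y_im i : exists u, f i u = y i.
  (* Unrolled, [y i] is a product of values of [f i] and of [proj q i (y J)], which is also such a
     value. *)
  have [J [le_iJ JP]] := epi i; rewrite (lim1_act_iter le_iJ yP).
  have [u fu] := JP J (y J) (leqnn J).
  exists (pprod p g i J * u * (pprod p g' i J)^-1).
  by rewrite !gmulfM homV !map_pprod fu.
have [u uP] := dep_choice y_im.
pose h i := (u i)^-1 * g i * p i (u i.+1).
have fh : (fun i => f i (h i)) = (fun i => f i (g' i)).
  by apply: functional_extensionality_dep => i; rewrite !gmulfM homV fpq !uP yP.
have -> : \pi_({eq_quot same_orbit p}) g = \pi_({eq_quot same_orbit p}) h.
  by apply/lim1_eqP; exists u.
clearbody h; have [J JP] := choice mono; apply/lim1_eqP.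
(* This is the unrolled equation for [x] with the middle term dropped. Cutting later than [J i]
   gives the same value, since the two tails have the same image under [f]. *)
pose x i := pprod p h i (J i) * (pprod p g' i (J i))^-1.
have xE i l : (J i <= l)%N -> x i = pprod p h i l * (pprod p g' i l)^-1.
  have [le_iJ JiP] := JP i => le_l; rewrite !(pprod_cat _ _ le_iJ le_l).
  rewrite invgM mulgA -(mulgA (pprod _ _ _ _)) -projV -projM.
  by rewrite (JiP (J i)) ?mulg1 // gmulfM homV !map_pprod fh mulgV.
exists x => i; pose l := maxn (J i) (J i.+1); have [le_iJS _] := JP i.+1.
have lt_il : (i < l)%N by rewrite (leq_trans le_iJS) ?leq_maxr.
rewrite (xE i l (leq_maxl _ _)) (xE i.+1 l (leq_maxr _ _)).
rewrite !(pprod_cons _ _ lt_il) gmulfM homV !invgM !invgK !mulgA.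
by rewrite mulgVK mulgVK mulgK.
Qed.

End MonoEpiLimits.

(** * The two conditions from bijectivity on lim and lim^1 *)

Section BijectiveLimits.
Hypotheses (countG : forall i, countable [set: G i]%classic)
  (countH : forall i, countable [set: H i]%classic).
Hypotheses (lim_bij : bijective (lim_map fpq))
  (lim1_bij : bijective (lim1_map f : lim1 p -> lim1 q)).

Lemma lim_lift (y : forall i, H i) : (forall i, q i (y i.+1) = y i) ->
  exists2 z : forall i, G i, (forall i, p i (z i.+1) = z i) & forall i, f i (z i) = y i.
Proof.
move=> limy; have [g _ gK] := lim_bij.
have := congr1 sval (gK (exist _ y limy)) => /=.
case: (g _) => z limz /= fz; exists z => // i.
exact: (congr1 (fun u => u i) fz).
Qed.

(** Injectivity on lim^1 yields some [x] trivializing [g]. Then [y] and the image of [x] differ by a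
    left factor in lim H; its lift [z] corrects [x] without changing the action on the base
    point. *)
Lemma lim1_lift_trivial (g : forall i, G i) (y : forall i, H i) :
  (forall i, f i (g i) = (y i)^-1 * q i (y i.+1)) ->
  exists2 x : forall i, G i, (forall i, g i = (x i)^-1 * p i (x i.+1)) &
    forall i, f i (x i) = y i.
Proof.
move=> fg; have : \pi_({eq_quot same_orbit p}) (fun=> 1) = \pi_({eq_quot same_orbit p}) g.
  apply: (bij_inj lim1_bij); rewrite !(lim1_map_pi fpq); apply/lim1_eqP.
  by exists y => i; rewrite fg hom1 mulg1.
move=> /lim1_eqP[x gE].
have [i|z limz fz] := lim_lift (y := fun i => y i * (f i (x i))^-1).
  have : (f i (x i))^-1 * q i (f i.+1 (x i.+1)) = (y i)^-1 * q i (y i.+1).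
    by rewrite -fg gE !gmulfM homV hom1 mulg1 fpq.
  rewrite gmulfM homV => /(congr1 (fun a => y i * a)).
  by rewrite mulVKg => <-; rewrite mulgA mulgK.
exists (fun i => z i * x i) => i; last by rewrite gmulfM fz mulgVK.
by rewrite gmulfM limz invgM gE mulg1 !mulgA mulgVK.
Qed.

(** Apply [pro_trivial] to 1 <= ker f_i. A family [h] of kernel elements is trivial in lim^1 through
    some [x] whose image under [f] is a point of lim H; dividing [x] by a lift [z] of it gives a
    solution inside the kernels. *)
Lemma bijective_pro_mono : pro_mono.
Proof.
pose K i (x : G i) := f i x = 1; pose I i (x : G i) := x = 1.
have subK : subsystem p K.
  split=> [i|i x y|i x|i x]; rewrite /K ?hom1 ?gmulfM ?homV ?fpq //.
  - by move=> -> ->; rewrite mulg1.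
  - by move=> ->; rewrite invg1.
  - by move=> ->; rewrite hom1.
have subI : subsystem p I.
  split=> [i|i x y|i x|i x]; rewrite /I //.
  - by move=> -> ->; rewrite mulg1.
  - by move=> ->; rewrite invg1.
  - by move=> ->; rewrite hom1.
have twisted h : (forall j, K j (h j)) -> exists2 x : forall j, G j,
    (forall j, K j (x j)) & forall j, I j ((x j)^-1 * h j * p j (x j.+1)).
  move=> Kh; have : \pi_({eq_quot same_orbit p}) h = \pi_({eq_quot same_orbit p}) (fun=> 1).
    apply: (bij_inj lim1_bij); rewrite !(lim1_map_pi fpq); congr (\pi _).
    by apply: functional_extensionality_dep => i; rewrite Kh hom1.
  move=> /lim1_eqP[x xP].
  have [i|z limz fz] := lim_lift (y := fun i => f i (x i)).
    rewrite -fpq; apply: (mulgI (f i (x i))^-1); rewrite mulVg.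
    have /(congr1 (f i)) := xP i; rewrite hom1 !gmulfM homV Kh mulg1; exact: esym.
  exists (fun i => x i * (z i)^-1) => i; first by rewrite /K gmulfM homV fz mulgV.
  rewrite /I gmulfM homV limz invgM invgK.
  (* The correction by [z] merely conjugates an expression equal to 1. *)
  rewrite [LHS](_ : _ = z i * ((x i)^-1 * h i * p i (x i.+1)) * (z i)^-1).
    by rewrite -xP mulg1 mulgV.
  by rewrite !mulgA.
have triv x : (forall j, K j (x j)) -> (forall j, I j ((x j)^-1 * p j (x j.+1))) ->
    forall j, I j (x j).
  move=> Kx limx; have lim_x j : p j (x j.+1) = x j.
    by apply: (mulgI (x j)^-1); rewrite mulVg limx.
  pose e : lim p := exist (fun x : forall i, G i => forall i, p i (x i.+1) = x i)
    (fun=> 1) (fun i => hom1 (p i)).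
  have : lim_map fpq (exist _ x lim_x) = lim_map fpq e.
    by apply: lim_eq => j /=; rewrite Kx hom1.
  move=> /(bij_inj lim_bij)/(congr1 sval)/= x1 j.
  exact: (congr1 (fun u => u j) x1).
move=> i; have [J le_iJ JP] := pro_trivial subK subI countG twisted triv i.
exists J; split=> // j x le_Jj fx; rewrite -(proj_trans _ _ le_iJ le_Jj).
by apply: JP; rewrite /K map_proj fx proj1.
Qed.

(** Apply [pro_trivial] to im f_i <= H_i. Surjectivity on lim^1 solves the twisted problem, and a
    point [x] of the untwisted coset limit trivializes some [f g], so [lim1_lift_trivial] lifts it
    to [G]. *)
Lemma bijective_pro_epi : pro_epi.
Proof.
pose I i (y : H i) := exists x, f i x = y.
have subT : subsystem q (fun _ _ => True) by [].
have subI : subsystem q I.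
  split=> [i|i _ _ [x <-] [y <-]|i _ [x <-]|i _ [x <-]].
  - by exists 1; rewrite hom1.
  - by exists (x * y); rewrite gmulfM.
  - by exists x^-1; rewrite homV.
  - by exists (p i x); rewrite fpq.
have twisted h : (forall j : nat, True) -> exists2 x : forall j, H j,
    (forall j : nat, True) & forall j, I j ((x j)^-1 * h j * q j (x j.+1)).
  move=> _; have [g _ gK] := lim1_bij.
  have := gK (\pi_({eq_quot same_orbit q}) h).
  rewrite -[g _]reprK (lim1_map_pi fpq) => /esym/lim1_eqP[x xP].
  by exists x => // i; rewrite -xP; exists (repr (g (\pi h)) i).
have triv x : (forall j : nat, True) -> (forall j, I j ((x j)^-1 * q j (x j.+1))) ->
    forall j, I j (x j).
  move=> _ /dep_choice[g gP]; have [u _ uP] := lim1_lift_trivial gP.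
  by move=> j; exists (u j).
move=> i; have [J le_iJ JP] := pro_trivial subT subI countH twisted triv i.
exists J; split=> // j y le_Jj; rewrite -(proj_trans _ _ le_iJ le_Jj).
exact: JP.
Qed.

End BijectiveLimits.
End ProMorphism.

Theorem theorem3p8 (G H : nat -> groupType)
    (p : forall i, {multiplicative G i.+1 -> G i})
    (q : forall i, {multiplicative H i.+1 -> H i})
    (f : forall i, {multiplicative G i -> H i})
    (countG : forall i, countable [set: G i]%classic)
    (countH : forall i, countable [set: H i]%classic)
    (fpq : commutes_with_bonds p q f) :
  pro_isomorphism p q f <->
  bijective (lim_map fpq) /\ bijective (lim1_map f : lim1 p -> lim1 q).
Proof.
split=> [/(pro_isomorphism_mono_epi fpq)[mono epi]|[lim_bij lim1_bij]].
  split; apply: inj_surj_bijective.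
  - exact: mono_lim_injective.
  - exact: mono_epi_lim_surjective.
  - exact: mono_epi_lim1_injective.
  - exact: epi_lim1_surjective.
apply: mono_epi_pro_isomorphism => //.
  exact: bijective_pro_mono lim_bij lim1_bij.
exact: bijective_pro_epi lim_bij lim1_bij.
Qed.
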